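(* Let $A$ be a finite-dimensional alternative real $*$-algebra with quadratic cone $Q_A$, let $G$ be a symmetric domain in $\mathbb{C}$ and let $\Omega_G\subset Q_A$ be the axially symmetric domain associated to $G$. Let $(x_n+y_ni)_{n\in\mathbb{N}}$ (with $x_n,y_n\in\mathbb{R}$) be a discrete sequence of distinct elements in $G^+=\{z\in G:\operatorname{Im}(z)\ge 0\}$. For every $n\in\mathbb{N}$ let $L_n:A\to A$ be a (left) affine linear function, $L_n(q)=a_n+qb_n$ for some $a_n,b_n\in A$. Then there exists a slice regular function $f:\Omega_G\to A$ such that $f$ and $L_n$ agree on $x_n+y_n\mathbb{S}_A$ for every $n\in\mathbb{N}$.
   Context: A finite-dimensional alternative real $*$-algebra $A$ is a finite-dimensional unital real algebra ($\mathbb{R}=\mathbb{R}\cdot 1\subset A$) with $x(xy)=(xx)y$ and $x(yy)=(xy)y$ for all $x,y\in A$, equipped with a real-linear involution $x\mapsto x^c$ satisfying $(xy)^c=y^cx^c$ and fixing $\mathbb{R}$ pointwise. The pseudosphere is $\mathbb{S}_A=\{w\in A: w+w^c=0,\ ww^c=1\}$ (so $w^2=-1$ for $w\in\mathbb{S}_A$); the quadratic cone is $Q_A=\mathbb{R}\cup\{w\in A: w+w^c\in\mathbb{R},\ ww^c\in\mathbb{R},\ 4ww^c>(w+w^c)^2\}$, equivalently $Q_A=\mathbb{R}\cup\{x+yI:x,y\in\mathbb{R},I\in\mathbb{S}_A\}$. A symmetric domain in $\mathbb{C}$ is a (non-empty) open subset $G$ with $z\in G\iff\bar z\in G$ whose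 quotient by the relation $z\sim w\iff(z=w\text{ or }z=\bar w)$ is connected. Its associated axially symmetric domain is $\Omega_G=\{x+yI: x+yi\in G,\ x,y\in\mathbb{R},\ I\in\mathbb{S}_A\}\subset Q_A$. A sequence in $G^+$ is discrete if it has no accumulation point in $G^+$. Let $A_{\mathbb{C}}=A\otimes_{\mathbb{R}}\mathbb{C}$, whose elements are written $a+ib$ with $a,b\in A$ ($i$ central), with complex conjugation $\overline{a+ib}=a-ib$. A (holomorphic) stem function is a holomorphic map $F:G\to A_{\mathbb{C}}$ with $F(\bar z)=\overline{F(z)}$ for all $z\in G$. A slice regular function on $\Omega_G$ is a function $f:\Omega_G\to A$ associated to (induced by) a stem function $F=F'+iF''$ ($F',F'':G\to A$) via $f(x+yI)=F'(x+yi)+I\,F''(x+yi)$ for $x+yi\in G$, $I\in\mathbb{S}_A$. *)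

(* Defs.v *)
From HB Require Import structures.
From mathcomp Require Import all_boot all_order all_algebra.
From mathcomp Require Import generic_quotient complex.
From mathcomp Require Import all_classical all_reals all_analysis.

Set Implicit Arguments.
Unset Strict Implicit.
Unset Printing Implicit Defensive.

Import Order.TTheory GRing.Theory Num.Theory.
Import numFieldNormedType.Exports.

Local Open Scope quotient_scope.
Local Open Scope classical_set_scope.
Local Open Scope complex_scope.
Local Open Scope ring_scope.

(* Finite-dimensionality comes from [Vector].  The algebra need not be
   associative, so it does not fit the ring hierarchy.  [aone_neq0] makes
   [r |-> r *: aone] injective, i.e. R is contained in A. *)
HB.mixin Record isAltStarAlgebra (R : realType) A of Vector R A := {
  amul : A -> A -> A;
  aone : A;
  aconj : A -> A;
  aone_neq0 : aone != 0;
  amul1x : left_id aone amul;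
  amulx1 : right_id aone amul;
  amul_linearl : forall y : A, linear (amul^~ y);
  amul_linearr : forall x : A, linear (amul x);
  amul_altl : forall x y : A, amul x (amul x y) = amul (amul x x) y;
  amul_altr : forall x y : A, amul x (amul y y) = amul (amul x y) y;
  aconj_linear : linear aconj;
  aconjK : involutive aconj;
  aconjM : forall x y : A, aconj (amul x y) = amul (aconj y) (aconj x);
  aconj_real : forall r : R, aconj (r *: aone) = r *: aone
}.

#[short(type="altStarAlgType")]
HB.structure Definition AltStarAlgebra (R : realType) :=
  { A of isAltStarAlgebra R A & Vector R A }.

Arguments aone {R} s.

Notation "x ** y" := (amul x y) (at level 40, left associativity) : ring_scope.

Section QuadraticCone.
Context {R : realType} (A : altStarAlgType R).

Definition pseudosphere : set A :=
  [set w | w + aconj w = 0 /\ w ** aconj w = aone A].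

Definition quadratic_cone : set A :=
  [set w | (exists r : R, w = r *: aone A) \/
    exists t n : R, [/\ w + aconj w = t *: aone A,
                        w ** aconj w = n *: aone A & t ^+ 2 < 4 * n]].

End QuadraticCone.
Arguments pseudosphere {R} A.
Arguments quadratic_cone {R} A.

Section SymmetricDomain.
Context {R : realType}.
(* [R[i]^o] is the copy of R[i] that carries the normed topology. *)
Implicit Types (G : set R[i]^o).

Definition conj_rel G : rel G :=
  fun z w => (val z == val w) || (val z == conjc (val w)).

Lemma conj_rel_refl G : reflexive (@conj_rel G).
Proof. by move=> z; rewrite /conj_rel eqxx. Qed.

Lemma conj_rel_sym G : symmetric (@conj_rel G).
Proof.
move=> z w; rewrite /conj_rel eq_sym; congr (_ || _).
by apply/eqP/eqP => ->; rewrite conjcK.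
Qed.

Lemma conj_rel_trans G : transitive (@conj_rel G).
Proof.
move=> w z u; rewrite /conj_rel.
move=> /orP[]/eqP-> /orP[]/eqP->; rewrite ?conjcK ?eqxx ?orbT //.
Qed.

Definition conj_equiv G : equiv_rel G :=
  EquivRel (@conj_rel G) (@conj_rel_refl G) (@conj_rel_sym G)
    (@conj_rel_trans G).

Definition conj_quotient G : topologicalType :=
  quotient_topology {eq_quot (conj_equiv G)}.

Definition symmetric_domain G : Prop :=
  [/\ G !=set0, open G, (forall z, G z <-> G (conjc z)) &
      connected [set: conj_quotient G]].

Definition upper_part G : set R[i]^o := [set z | G z /\ 0 <= complex.Im z].

Definition discrete_seq_in (E : set R[i]^o) (u : nat -> R[i]^o) : Prop :=
  E `&` cluster (u @ \oo) = set0.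

End SymmetricDomain.

(* A (x)_R C, with (a, b) standing for a + ib. *)
Definition complexification {R : realType} (A : vectType R) : Type :=
  (A * A)%type.

Section Complexification.
Context {R : realType} (A : vectType R).
Local Notation AC := (complexification A).
Implicit Types (c d : R[i]) (w : AC).

HB.instance Definition _ := GRing.Zmodule.copy AC (A * A)%type.

Definition complexification_scale c w : AC :=
  (complex.Re c *: w.1 - complex.Im c *: w.2,
   complex.Re c *: w.2 + complex.Im c *: w.1).

Lemma complexification_scaleA c d w :
  complexification_scale c (complexification_scale d w) =
  complexification_scale (c * d) w.
Proof.
case: c => c1 c2; case: d => d1 d2; case: w => a b.
rewrite /complexification_scale /=; congr pair;
  rewrite !scalerDr ?scalerN !scalerA !scalerDl ?scaleNr ?opprD.
  by rewrite -!addrA; congr (_ + _); rewrite [RHS]addrC addrA.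
by rewrite -!addrA; congr (_ + _); rewrite [RHS]addrC addrA.
Qed.

Lemma complexification_scale1 : left_id 1 complexification_scale.
Proof.
move=> [a b]; rewrite /complexification_scale /=.
by rewrite !scale1r !scale0r subr0 addr0.
Qed.

Lemma complexification_scaleDr :
  right_distributive complexification_scale +%R.
Proof.
move=> c [a b] [a' b']; rewrite /complexification_scale /=.
by congr pair; rewrite /= !scalerDr ?opprD addrACA.
Qed.

Lemma complexification_scaleDl w :
  {morph complexification_scale^~ w : c d / c + d}.
Proof.
move=> [c1 c2] [d1 d2]; case: w => a b; rewrite /complexification_scale /=.
by congr pair; rewrite /= !scalerDl ?opprD addrACA.
Qed.

HB.instance Definition _ := GRing.Zmodule_isLmodule.Build R[i] AC
  complexification_scaleA complexification_scale1
  complexification_scaleDr complexification_scaleDl.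

Definition complexification_coord w : 'rV[R[i]]_(\dim {:A}) :=
  \row_k (coord (vbasis {:A}) k w.1 +i* coord (vbasis {:A}) k w.2).

Lemma complexification_coordD w w' :
  complexification_coord (w + w') =
  complexification_coord w + complexification_coord w'.
Proof. by apply/rowP => k; rewrite !mxE !linearD; simpc. Qed.

Lemma complexification_coordZ c w :
  complexification_coord (c *: w) = c *: complexification_coord w.
Proof.
apply/rowP => k; rewrite !mxE /= !linearD !linearN !linearZ /=.
by case: c => c1 c2; rewrite /GRing.scale /=; simpc.
Qed.

(* The maximum of the absolute values of the complex coordinates.  All norms
   on this finite-dimensional space are equivalent, so this choice fixes no
   more than the topology. *)
Definition complexification_norm w : R[i] := `|complexification_coord w|.

Lemma complexification_normD w w' :
  complexification_norm (w + w') <=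
  complexification_norm w + complexification_norm w'.
Proof. by rewrite /complexification_norm complexification_coordD ler_normD. Qed.

Lemma complexification_normZ c w :
  complexification_norm (c *: w) = `|c| * complexification_norm w.
Proof. by rewrite /complexification_norm complexification_coordZ normrZ. Qed.

Lemma complexification_norm_eq0 w : complexification_norm w = 0 -> w = 0.
Proof.
move=> /normr0_eq0/rowP w0; case: w w0 => a b w0.
congr pair; [rewrite (coord_vbasis (memvf a)) | rewrite (coord_vbasis (memvf b))];
  by rewrite big1// => k _; have := w0 k; rewrite !mxE => -[/= a0 b0];
     rewrite ?a0 ?b0 scale0r.
Qed.

HB.instance Definition _ := Lmodule_isNormed.Build R[i] AC
  complexification_normD complexification_normZ complexification_norm_eq0.

Definition complexification_conj w : AC := (w.1, - w.2).

End Complexification.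

Section SliceRegular.
Context {R : realType} (A : altStarAlgType R).
Implicit Types (G : set R[i]^o).

Definition slice_point (z : R[i]) (I : A) : A :=
  complex.Re z *: aone A + complex.Im z *: I.

Definition axially_symmetric G : set A :=
  [set q | exists z I, [/\ G z, pseudosphere A I & q = slice_point z I]].

(* Differentiability over R[i] in the direction 1 is complex
   differentiability. *)
Definition holomorphic_on G (F : R[i]^o -> complexification A) : Prop :=
  forall z, G z -> derivable F z 1.

Definition stem_function G (F : R[i]^o -> complexification A) : Prop :=
  holomorphic_on G F /\
  forall z, G z -> F (conjc z) = complexification_conj (F z).

Definition slice_regular G (f : axially_symmetric G -> A) : Prop :=
  exists2 F : R[i]^o -> complexification A, stem_function G F &
    forall (z : R[i]) (I : A) (q : axially_symmetric G),
      G z -> pseudosphere A I -> set_val q = slice_point z I ->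
      f q = (F z).1 + I ** (F z).2.

Definition left_affine (L : A -> A) : Prop :=
  exists a b : A, forall q, L q = a + q ** b.

Definition sphere (x y : R) : set A :=
  [set x *: aone A + y *: I | I in pseudosphere A].

Lemma axially_symmetric_sub G : axially_symmetric G `<=` quadratic_cone A.
Proof.
move=> _ [[x y] [I [_ [Ic IIc] ->]]]; rewrite /slice_point /=.
have [-> | y0] := eqVneq y 0; first by left; exists x; rewrite scale0r addr0.
right; exists (x *+ 2), (x ^+ 2 + y ^+ 2).
have conj_lin a (u v : A) : aconj (a *: u + v) = a *: aconj u + aconj v.
  exact: aconj_linear.
have conjI : aconj I = - I by apply/eqP; rewrite -addr_eq0 addrC Ic.
pose p := x *: aone A + y *: I.
have pc : aconj p = x *: aone A - y *: I.
  have conjV : aconj (y *: I) = - (y *: I).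
    have c0 : aconj (0 : A) = 0.
      by have := aconj_real (s := A) 0; rewrite !scale0r.
    by rewrite -[X in aconj X]addr0 conj_lin c0 addr0 conjI scalerN.
  have := conj_lin x (aone A) (y *: I); rewrite -/p conjV => ->.
  by have := aconj_real (s := A) 1; rewrite !scale1r => ->.
have mulr u (v w : A) c : u ** (c *: v + w) = c *: (u ** v) + u ** w.
  exact: amul_linearr.
have mull u c (v w : A) : (c *: v + w) ** u = c *: (v ** u) + w ** u.
  exact: amul_linearl.
have mul0 (u : A) : u ** 0 = 0.
  by apply: (addrI (u ** 0)); have := mulr u 0 0 1; rewrite !scale1r !addr0.
have mul0l (u : A) : 0 ** u = 0.
  by apply: (addrI (0 ** u)); have := mull u 1 0 0; rewrite !scale1r !addr0.
have mulZr u (v : A) c : u ** (c *: v) = c *: (u ** v).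
  by rewrite -[c *: v]addr0 mulr mul0 addr0.
have mulZl u (v : A) c : (c *: v) ** u = c *: (v ** u).
  by rewrite -[c *: v]addr0 mull mul0l addr0.
rewrite -/p pc; split.
- by rewrite /p addrACA subrr addr0 -scalerDl mulr2n.
- rewrite /p mull -scaleNr !mulZl !mulr !mulZr !amulx1 !amul1x.
  have II : I ** I = - aone A.
    have := mulZr I I (-1); rewrite !scaleN1r -conjI IIc => /esym/eqP.
    by rewrite eqr_oppLR => /eqP.
  rewrite II !scaleNr scalerN opprK !scalerDr scalerN !scalerA [y * x]mulrC.
  by rewrite addrA subrK -scalerDl !expr2.
- rewrite -[x *+ 2]mulr_natl exprMn -natrX mulrDr ltrDl mulr_gt0 ?ltr0n//.
  by rewrite exprn_even_gt0.
Qed.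

End SliceRegular.
Arguments axially_symmetric {R} A G.
Arguments sphere {R} A x y.

(* Main.v *)
Require Import Defs.
From HB Require Import structures.
From mathcomp Require Import all_boot all_order all_algebra.
From mathcomp Require Import generic_quotient complex.
From mathcomp Require Import all_classical all_reals all_analysis.
From mathcomp Require Import ring.

Set Implicit Arguments.
Unset Strict Implicit.
Unset Printing Implicit Defensive.

Import Order.TTheory GRing.Theory Num.Theory.
Import numFieldNormedType.Exports.

Local Open Scope classical_set_scope.
Local Open Scope complex_scope.
Local Open Scope ring_scope.

(** Write [z_n = x_n + i y_n] and [L_n q = a_n + q b_n].  Since
    [(x + y I) b = x b + I (y b)], the function induced by a stem function [F]
    agrees with [L_n] on the sphere over [z_n] as soon as
    [F z_n = (a_n + x_n b_n) + i (y_n b_n)], so the theorem is an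
    interpolation problem for holomorphic maps into [A_C] that commute with
    conjugation.  In a real basis of [A] it splits into scalar problems, and
    averaging [g t] with the conjugate of [g (conj t)] makes a scalar solution
    [g] symmetric.  The prescribed values at [z_n] and at its conjugate do not
    conflict: for real [z_n] the required value has no imaginary part
    ([stem_interpolation], [symmetric_interpolation]).

    The scalar problem, to find [g] holomorphic on [G] with [g w_n = c_n] for
    a sequence [w_n] leaving every compact part of [G], is solved without
    infinite products and without integral formulas ([interpolation]).  The
    solution is a series of rational functions [f_n] chosen one after the
    other: [f_n] vanishes at the earlier points, repairs the value at [w_n],
    and is tiny on a large compact set [E] that misses [w_n].  Vanishing is
    achieved by a polynomial factor.  Smallness is achieved by a high power of
    a peak function [h] with [h w_n = 1] and [|h| <= 1/4] on [E]
    ([peak_function]): if [w_n] is far from [0], take [h z = z / w_n]; if it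
    is close to a point [p] outside [G], take [h z = (w_n - p) / (z - p)].
    The sets of [exhaustion] are made so that one of the two cases applies.

    To see that the sum is holomorphic, the terms are estimated together with
    their Lipschitz constants on [E].  Then the difference quotients of the
    sum are uniformly approximated by those of the partial sums, hence form a
    Cauchy filter ([derivable_lip_limit]).  All of this works over any
    Archimedean field with an absolute value in which closed balls are
    compact. *)

(** * Bounded Lipschitz functions *)

(** One constant bounds both the values and the difference quotients.  The
    second bound plays the part of an estimate on derivatives: it behaves well
    under products and pointwise limits, with no convexity of [E]. *)
Definition lip_bounded (K : numFieldType) (E : set K) (f : K -> K) (B : K) :=
  forall z, E z -> `|f z| <= B /\
    forall z', E z' -> `|f z - f z'| <= B * `|z - z'|.

Section LipBounded.
Context {K : numFieldType} (E : set K).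
Implicit Types (f g h : K -> K) (B C : K).

Lemma lip_bounded_ge0 f B z : lip_bounded E f B -> E z -> 0 <= B.
Proof. by move=> fB /fB[fzB _]; exact: le_trans fzB. Qed.

Lemma lip_bounded_le f B C : B <= C -> lip_bounded E f B -> lip_bounded E f C.
Proof.
move=> BC fB z Ez; have [fz fzz] := fB z Ez; split; first exact: le_trans BC.
by move=> z' Ez'; apply: le_trans (fzz z' Ez') _; rewrite ler_wpM2r.
Qed.

Lemma lip_bounded_cst (a : K) : lip_bounded E (fun=> a) `|a|.
Proof. by move=> z Ez; split=> // z' Ez'; rewrite subrr normr0 mulr_ge0. Qed.

Lemma lip_bounded0 : lip_bounded E (fun=> 0) 0.
Proof.
by rewrite -[X in lip_bounded _ _ X](normr0 K); exact: lip_bounded_cst.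
Qed.

Lemma lip_boundedM f g B C : lip_bounded E f B -> lip_bounded E g C ->
  lip_bounded E (fun z => f z * g z) (B * C *+ 2).
Proof.
move=> fB gC z Ez.
have B0 := lip_bounded_ge0 fB Ez; have C0 := lip_bounded_ge0 gC Ez.
have [fz fzz] := fB z Ez; have [gz gzz] := gC z Ez; split.
  rewrite normrM mulr2n -[leLHS]addr0 lerD ?mulr_ge0 //.
  by rewrite ler_pM.
move=> z' Ez'; have [gz' _] := gC z' Ez'.
have -> : f z * g z - f z' * g z' = f z * (g z - g z') + (f z - f z') * g z'.
  by rewrite mulrBr mulrBl addrA subrK.
apply: le_trans (ler_normD _ _) _; rewrite !normrM mulr2n mulrDl lerD //.
  by rewrite -mulrA ler_pM ?gzz.
by rewrite mulrAC ler_pM ?fzz.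
Qed.

Lemma lip_bounded_id B : (forall z, E z -> `|z| <= B) ->
  lip_bounded E id (B + 1).
Proof.
move=> EB z Ez; have zB := EB z Ez.
have B0 : 0 <= B by exact: le_trans zB.
split; first by apply: le_trans zB _; rewrite lerDl.
by move=> z' _; rewrite mulrDl mul1r lerDr mulr_ge0.
Qed.

Lemma lip_boundedD f g B C : lip_bounded E f B -> lip_bounded E g C ->
  lip_bounded E (fun z => f z + g z) (B + C).
Proof.
move=> fB gC z Ez.
have [fz fzz] := fB z Ez; have [gz gzz] := gC z Ez; split.
  by apply: le_trans (ler_normD _ _) _; rewrite lerD.
move=> z' Ez'; rewrite opprD addrACA mulrDl.
by apply: le_trans (ler_normD _ _) _; rewrite lerD ?fzz ?gzz.
Qed.

Lemma lip_bounded_prod B (s : seq K) (a : K -> K) :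
  (forall z, E z -> `|z| <= B) ->
  exists C, lip_bounded E (fun z => \prod_(v <- s) (a v * (z - v))) C.
Proof.
move=> EB; elim: s => [|v s [C sC]].
  exists `|1|; under eq_fun do rewrite big_nil.
  exact: lip_bounded_cst.
eexists; under eq_fun do rewrite big_cons.
apply: lip_boundedM sC; apply: lip_boundedM; first exact: lip_bounded_cst.
apply: lip_boundedD (lip_bounded_cst _); exact: lip_bounded_id EB.
Qed.

(** If [|h| <= 1/4], then [|h ^ N| <= 4 ^ -N] and [h ^ N] has Lipschitz
    constant at most [4 C N 4 ^ -N]; as [N <= 2 ^ N], half of the decay absorbs
    the factor [N]. *)
Lemma lip_boundedX h C N : (forall z, E z -> `|h z| <= 4^-1) ->
  (forall z z', E z -> E z' -> `|h z - h z'| <= C * `|z - z'|) ->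
  0 <= C -> lip_bounded E (fun z => h z ^+ N) ((1 + 4 * C) * 2^-1 ^+ N).
Proof.
move=> h4 hC C0.
have hX n z : E z -> `|h z ^+ n| <= 4^-1 ^+ n.
  by move=> Ez; rewrite normrX lerXn2r ?nnegrE ?h4 // invr_ge0 ler0n.
have hL n z z' : E z -> E z' ->
    `|h z ^+ n - h z' ^+ n| <= 4 * C * n%:R * 4^-1 ^+ n * `|z - z'|.
  move=> Ez Ez'; elim: n => [|n IH].
    by rewrite !expr0 subrr normr0 mulr0 !mul0r.
  have -> : h z ^+ n.+1 - h z' ^+ n.+1 =
            h z * (h z ^+ n - h z' ^+ n) + (h z - h z') * h z' ^+ n.
    by rewrite !exprS mulrBr mulrBl addrA subrK.
  apply: le_trans (ler_normD _ _) _; rewrite !normrM.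
  have -> : 4 * C * n.+1%:R * 4^-1 ^+ n.+1 * `|z - z'| =
    4^-1 * (4 * C * n%:R * 4^-1 ^+ n * `|z - z'|) +
    (C * `|z - z'|) * 4^-1 ^+ n.
    have n4 : (4 : K) != 0 by rewrite pnatr_eq0.
    rewrite -natr1 exprS; move: (_^-1 ^+ n) => e.
    by field.
  by rewrite lerD // ler_pM ?h4 ?hX ?hC //.
have e42 n : n%:R * 4^-1 ^+ n <= 2^-1 ^+ n :> K.
  rewrite -[4%N]/(2 * 2)%N natrM invfM exprMn mulrA.
  rewrite -[leRHS]mul1r ler_wpM2r ?exprn_ge0 ?invr_ge0 //.
  rewrite exprVn ler_pdivrMr ?exprn_gt0 // mul1r -natrX ler_nat.
  by rewrite ltnW // ltn_expl.
have e42' n : 4^-1 ^+ n <= 2^-1 ^+ n :> K.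
  rewrite lerXn2r ?nnegrE ?invr_ge0 ?ler0n // lef_pV2 ?posrE ?ltr0n //.
  by rewrite ler_nat.
move=> z Ez; split.
  apply: le_trans (hX N z Ez) _; apply: le_trans (e42' N) _.
  by rewrite ler_peMl ?exprn_ge0 ?invr_ge0 // lerDl mulr_ge0.
move=> z' Ez'; apply: le_trans (hL N z z' Ez Ez') _.
rewrite ler_wpM2r // -mulrA [leRHS]mulrDl mul1r -[leLHS]add0r lerD //.
by rewrite ler_wpM2l ?mulr_ge0.
Qed.

End LipBounded.

(** * Rational corrections *)

(** The points of norm at most [j + 1] at distance at least [1 / (j + 1)] from
    the complement of [G], described without a distance function so that
    [G] may be the whole field. *)
Definition exhaustion (K : numFieldType) (G : set K) (j : nat) : set K :=
  [set z | `|z| <= j.+1%:R /\ forall p, ~ G p -> j.+1%:R^-1 <= `|z - p|].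

Section Corrections.
Context {K : numFieldType} (G : set K).

Lemma exhaustion_le i j : (i <= j)%N -> exhaustion G i `<=` exhaustion G j.
Proof.
move=> ij z [zi iz]; split.
  by apply: le_trans zi _; rewrite ler_nat.
move=> p Gp; apply: le_trans (iz p Gp).
by rewrite lef_pV2 ?posrE ?ltr0n // ler_nat.
Qed.

(** The index [4 j + 3] makes the defining bounds [4 (j + 1)] and
    [1 / (4 (j + 1))], a factor [4] away from those at [j].  A point [w] that
    violates the first is far enough out for [z / w], and one that violates
    the second is close enough to some [p] outside [G] for
    [(w - p) / (z - p)]. *)
Lemma peak_function j w : G w -> ~ exhaustion G (4 * j + 3)%N w ->
  exists h : K -> K, exists2 C, 0 <= C &
    [/\ h w = 1, forall z, G z -> derivable h z 1,
        forall z, exhaustion G j z -> `|h z| <= 4^-1 &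
        forall z z', exhaustion G j z -> exhaustion G j z' ->
          `|h z - h z'| <= C * `|z - z'|].
Proof.
move=> Gw far_w.
have j4 : (4 * j + 3).+1%:R = 4 * j.+1%:R :> K.
  by rewrite -natrM; congr (_%:R); rewrite mulnS addnC.
have [w_le|w_gt] := pselect (`|w| <= (4 * j + 3).+1%:R); last first.
  have {}w_gt : 4 * j.+1%:R < `|w|.
    by rewrite -j4 real_ltNge ?realn ?normr_real //; apply/negP.
  have w0 : 0 < `|w| by exact: le_lt_trans w_gt; rewrite mulr_ge0.
  have w_neq0 : w != 0 by rewrite -normr_gt0.
  exists (fun z => z * w^-1), `|w^-1|; first exact: normr_ge0.
  split.
  - by rewrite divff.
  - move=> z Gz.
    have h := derivableM (@derivable_id _ _ z 1) (derivable_cst (w^-1) z 1).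
    exact: h.
  - move=> z [zj _]; rewrite normrM normfV ler_pdivrMr // (le_trans zj) //.
    by rewrite -ler_pdivrMl ?invr_gt0 // invrK ltW.
  - by move=> z z' _ _; rewrite -mulrBl normrM mulrC.
have /existsNP[p /not_implyP[Gp /negP p_w]] :
    ~ forall p, ~ G p -> (4 * j + 3).+1%:R^-1 <= `|w - p|.
  by move=> h; apply: far_w.
have {}p_w : `|w - p| <= 4^-1 * j.+1%:R^-1.
  by rewrite -invfM -j4 ltW // real_ltNge ?normr_real // realV realn.
have p_neq z : G z -> z - p != 0.
  by move=> Gz; rewrite subr_eq0; apply/eqP => zp; apply: Gp; rewrite -zp.
have p_neq' z : exhaustion G j z -> 0 < `|z - p|.
  by move=> [_ /(_ p Gp)]; apply: lt_le_trans; rewrite invr_gt0 ltr0n.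
exists (fun z => (w - p) * (z - p)^-1), (`|w - p| * j.+1%:R ^+ 2).
  by rewrite mulr_ge0 ?exprn_ge0.
split.
- by rewrite divff ?p_neq.
- move=> z Gz.
  have h1 : derivable (fun z : K => z - p) z 1.
    have h := derivableB (@derivable_id _ _ z 1) (derivable_cst p z 1).
    exact: h.
  have h2 := @derivableV _ _ (fun z : K => z - p) z 1 (p_neq z Gz) h1.
  have h := derivableM (derivable_cst (w - p) z 1) h2.
  exact: h.
- move=> z zj; rewrite normrM normfV ler_pdivrMr ?p_neq' //.
  apply: le_trans p_w _; rewrite ler_wpM2l ?invr_ge0 //.
  by case: zj => _; exact.
- move=> z z' zj zj'.
  have zp := p_neq' z zj; have zp' := p_neq' z' zj'.
  have -> : (w - p) * (z - p)^-1 - (w - p) * (z' - p)^-1 =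
      (w - p) * ((z - p)^-1 * (z' - p)^-1) * (z' - z).
    have z0 : z - p != 0 by rewrite -normr_gt0.
    have z0' : z' - p != 0 by rewrite -normr_gt0.
    by field; rewrite z0 z0'.
  rewrite !normrM [`|z' - z|]distrC ler_wpM2r // ler_wpM2l // !normfV.
  have far_p t : exhaustion G j t -> `|t - p|^-1 <= j.+1%:R.
    move=> tj; rewrite -[leRHS]invrK lef_pV2 ?posrE ?invr_gt0 ?ltr0n ?p_neq' //.
    by case: tj => _; exact.
  by rewrite expr2 ler_pM ?invr_ge0 ?far_p.
Qed.

Context (K_archi : forall x : K, 0 <= x -> exists n, x <= n%:R).

Lemma geometric_small (B e : K) : 0 <= B -> 0 < e ->
  exists N, B * 2^-1 ^+ N <= e.
Proof.
move=> B0 e0; have [N BN] := K_archi (divr_ge0 B0 (ltW e0)).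
exists N; rewrite exprVn ler_pdivrMr ?exprn_gt0 // mulrC -ler_pdivrMr //.
apply: le_trans BN _.
by rewrite -natrX ler_nat ltnW // ltn_expl.
Qed.

Lemma derivable_prod (s : seq K) (a : K -> K) z :
  derivable (fun z : K => \prod_(v <- s) (a v * (z - v))) z 1.
Proof.
elim: s => [|v s IH].
  have -> : (fun z : K => \prod_(v <- [::]) (a v * (z - v))) = cst 1.
    by apply/funext => t; rewrite big_nil.
  exact: derivable_cst.
have -> : (fun z : K => \prod_(v <- v :: s) (a v * (z - v))) =
  (cst (a v) * (id - cst v)) * (fun z : K => \prod_(v <- s) (a v * (z - v))).
  by apply/funext => t; rewrite big_cons.
apply: derivableM IH; apply: derivableM; first exact: derivable_cst.
by apply: derivableB; [exact: derivable_id|exact: derivable_cst].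
Qed.

(** The correction is [c P h ^ N], with [P] the normalised product of the
    [z - v], [v] in [s], and [h] a peak function.  The bound is demanded for all
    [j <= n] that [w] escapes; these [exhaustion] sets increase, so the peak
    function of the largest such [j] serves them all. *)
Lemma correction n (s : seq K) w c : G w ->
  exists f : K -> K,
    [/\ forall z, G z -> derivable f z 1,
        forall v, v \in s -> f v = 0, w \notin s -> f w = c &
        forall j, (j <= n)%N -> ~ exhaustion G (4 * j + 3)%N w ->
          lip_bounded (exhaustion G j) f (2^-1 ^+ n.+1)].
Proof.
move=> Gw.
have [ws|ws] := boolP (w \in s).
  exists (fun=> 0); split => //.
  move=> j _ _; apply: lip_bounded_le (lip_bounded_cst (0 : K)).
  by rewrite normr0 exprn_ge0 // invr_ge0.
pose P z := \prod_(v <- s) ((w - v)^-1 * (z - v)).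
have P0 v : v \in s -> P v = 0.
  by move=> vs; rewrite /P (big_rem v) //= subrr mulr0 mul0r.
have P1 : P w = 1.
  rewrite /P big_seq big1 // => v vs; rewrite mulVf // subr_eq0.
  by apply: contraNneq ws => ->.
have dP z : derivable P z 1 by exact: derivable_prod.
pose far j := (j <= n)%N && `[< ~ exhaustion G (4 * j + 3)%N w >].
have [[i far_i]|no_far] := pselect (exists j, far j); last first.
  exists (fun z => c * P z); split => //.
  - move=> z _; have h := derivableM (derivable_cst c z 1) (dP z); exact: h.
  - by move=> v /P0 ->; rewrite mulr0.
  - by rewrite P1 mulr1.
  - move=> j jn far_j; case: no_far; exists j; rewrite /far jn.
    exact/asboolP.
have far_n j : far j -> (j <= n)%N by case/andP.
case: (ex_maxnP (ex_intro far i far_i) far_n).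
move=> J /andP[Jn /asboolP far_J] J_max.
have [h [C C0 [h1 dh h4 hC]]] := peak_function Gw far_J.
have [B PB] := @lip_bounded_prod _ (exhaustion G J) J.+1%:R s
  (fun v => (w - v)^-1) (fun z Ez => proj1 Ez).
pose M := `|c| * (B * (1 + 4 * C) *+ 2) *+ 2.
have e0 : 0 < 2^-1 ^+ n.+1 :> K by rewrite exprn_gt0 // invr_gt0.
have [N MN] := geometric_small (normr_ge0 M) e0.
exists (fun z => c * (P z * h z ^+ N)); split.
- move=> z Gz.
  have := derivableX (n := N) (dh z Gz); rewrite exprfctE => dhN.
  have h2 := derivableM (derivable_cst c z 1) (derivableM (dP z) dhN).
  exact: h2.
- by move=> v /P0 ->; rewrite mul0r mulr0.
- by rewrite P1 h1 expr1n !mulr1.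
- move=> j jn far_j z Ez.
  have jJ : (j <= J)%N by apply: J_max; rewrite /far jn; apply/asboolP.
  have Ez' := exhaustion_le jJ Ez.
  suff : lip_bounded (exhaustion G J) (fun z => c * (P z * h z ^+ N))
           (2^-1 ^+ n.+1).
    move=> /(_ z Ez')[fz fzz]; split => // z' Ez1.
    by apply: fzz; exact: exhaustion_le Ez1.
  apply: lip_bounded_le (lip_boundedM (lip_bounded_cst c)
    (lip_boundedM PB (lip_boundedX N h4 hC C0))).
  apply: le_trans MN.
  have B0 := lip_bounded_ge0 PB Ez'.
  have M0 : 0 <= M.
    rewrite mulrn_wge0 ?mulr_ge0 ?mulrn_wge0 // ?mulr_ge0 //.
    by rewrite addr_ge0 ?mulr_ge0.
  by rewrite (ger0_norm M0) /M !(mulrnAl, mulrnAr, mulrA).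
Qed.

(** Points may be repeated, provided that the prescribed values agree: at a
    repeated point the earlier terms have already produced the right value, and
    the correction vanishes there. *)
Lemma interpolating_sums (w c : nat -> K) : (forall n, G (w n)) ->
  (forall n m, w n = w m -> c n = c m) ->
  exists S : nat -> K -> K,
    [/\ forall n z, G z -> derivable (S n) z 1,
        forall n m, (n < m)%N -> S m (w n) = c n &
        forall n j, (j <= n)%N -> ~ exhaustion G (4 * j + 3)%N (w n) ->
          lip_bounded (exhaustion G j) (fun z => S n.+1 z - S n z)
            (2^-1 ^+ n.+1)].
Proof.
move=> Gw wc.
have /choice[corr corrP] := fun na : nat * K =>
  correction na.1 (mkseq w na.1) na.2 (Gw na.1).
pose fix S n : K -> K := if n is m.+1
  then fun z => S m z + corr (m, c m - S m (w m)) z else fun=> 0.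
have SS n z : S n.+1 z = S n z + corr (n, c n - S n (w n)) z by [].
have mem_w n m : (m < n)%N -> w m \in mkseq w n.
  by move=> mn; apply/mapP; exists m; rewrite ?mem_iota.
have S_stable n m : (n < m)%N -> S m (w n) = S n.+1 (w n).
  elim: m => // m IH; rewrite ltnS leq_eqVlt => /predU1P[->//|nm].
  have [_ vanish _ _] := corrP (m, c m - S m (w m)).
  by rewrite SS vanish ?mem_w // addr0 IH.
have Sw n : S n.+1 (w n) = c n.
  elim/ltn_ind: n => n IH.
  have [_ _ hit _] := corrP (n, c n - S n (w n)).
  have [|/hit ws] := boolP (w n \in mkseq w n).
    2: by rewrite SS ws addrC subrK.
  move=> /mapP[m]; rewrite mem_iota add0n => /andP[_ mn] wnm.
  by rewrite wnm (S_stable m n.+1) ?ltnS ?(ltnW mn) // IH // (wc n m).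
exists S; split.
- elim=> [|n IH] z Gz; first exact: derivable_cst.
  have [dcorr _ _ _] := corrP (n, c n - S n (w n)).
  have h := derivableD (IH z Gz) (dcorr z Gz); exact: h.
- by move=> n m nm; rewrite S_stable.
- move=> n j jn far_j.
  have [_ _ _ small] := corrP (n, c n - S n (w n)).
  have -> : (fun z => S n.+1 z - S n z) = corr (n, c n - S n (w n)).
    by apply/funext => z; rewrite SS addrC addKr.
  exact: small.
Qed.

End Corrections.

(** * Holomorphy of Lipschitz limits *)

Section Limits.
Context {K : numFieldType}.

Lemma norm_lim_le (u : nat -> K) (l B : K) m : u n @[n --> \oo] --> l ->
  (forall n, (m <= n)%N -> `|u n| <= B) -> `|l| <= B.
Proof.
move=> /cvgrPdist_le ul uB; apply/ler_addgt0Pr => e e0.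
have [N _ le_e] := ul e e0.
have /= := le_e (maxn N m) (leq_maxl _ _).
have := uB (maxn N m) (leq_maxr _ _) => uBn le_en.
rewrite -[l](subrK (u (maxn N m))) addrC [leRHS]addrC.
by rewrite addrC (le_trans (ler_normD _ _)) // lerD.
Qed.

Lemma closed_norm_le (M : K) :
  closed [set z : K | `|z| <= M].
Proof.
move=> z clz; apply/ler_addgt0Pr => e e0.
have [t [/= tM]] := clz _ (nbhsx_ballx z e e0).
rewrite -ball_normE /= => zt; rewrite -[z](subrK t) addrC.
by apply: le_trans (ler_normD _ _) _; rewrite lerD // ltW.
Qed.

Lemma lip_bounded_lim (E : set K) (f : nat -> K -> K) (g : K -> K) (B : K) m :
  (forall z, E z -> f n z @[n --> \oo] --> g z) ->
  (forall n, (m <= n)%N -> lip_bounded E (f n) B) ->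
  lip_bounded E g B.
Proof.
move=> fg fB z Ez; split.
  by apply: norm_lim_le (fg z Ez) _ => n /fB/(_ z Ez)[].
move=> z' Ez'; apply: (norm_lim_le (cvgB (fg z Ez) (fg z' Ez'))) => n mn.
by have [_] := fB n mn z Ez; apply.
Qed.

Context (closed_ball_compact :
  forall M : K, compact [set z : K | `|z| <= M]).

Lemma bounded_cauchy_cvg (F : set_system K) (M : K) :
  ProperFilter F -> F [set z : K | `|z| <= M] -> cauchy_ex F -> cvg F.
Proof.
move=> FF FM /cauchy_exP Fc.
exact: compact_cauchy_cvg FM (@closed_ball_compact M).
Qed.

(** The Lipschitz bound says that the difference quotients of [g] at [z] stay
    within [e] of those of [f], which converge.  So the quotients of [g] are
    Cauchy, and they converge because they are bounded. *)
Lemma derivable_lip_limit (E : set K) (g : K -> K) z : nbhs z E ->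
  (forall e, 0 < e -> exists2 f : K -> K, derivable f z 1 &
     lip_bounded E (fun t => g t - f t) e) ->
  derivable g z 1.
Proof.
move=> zE approx; rewrite /derivable.
set Q := (fun h : K => _).
have near_f e : 0 < e -> exists d, \forall h \near 0^', `|d - Q h| < e.
  move=> e0.
  have e2 : 0 < e / 2 by rewrite divr_gt0.
  have [f df fe] := approx (e / 2) e2.
  exists ('D_1 f z).
  have Ez : E z by exact: nbhs_singleton.
  have /cvgrPdist_lt/(_ _ e2) Qf := df.
  have hE : \forall h \near (0 : K)^', E (h *: 1 + z).
    apply: nbhs_dnbhs; near=> h; rewrite [h *: 1]mulr1 addrC.
    near: h; exact: (proj1 (nbhs0P E z) zE).
  have h_neq0 : \forall h \near (0 : K)^', h != 0 by exact: nbhs_dnbhs_neq.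
  near=> h.
  have h0 : h != 0 by near: h.
  have Eh : E (h *: 1 + z) by near: h.
  have Qfh : `|'D_1 f z - h^-1 *: (f (h *: 1 + z) - f z)| < e / 2 by near: h.
  have fgh : `|h^-1 *: (f (h *: 1 + z) - f z) - Q h| <= e / 2.
    have [_ /(_ z Ez)] := fe _ Eh.
    have -> : h *: 1 = h by exact: mulr1.
    have -> : h^-1 *: (f (h + z) - f z) - Q h =
        - (h^-1 * (g (h + z) - f (h + z) - (g z - f z))).
      by rewrite /Q /= /GRing.scale /= mulr1; ring.
    rewrite normrN normrM normfV ler_pdivrMl ?normr_gt0 //.
    by rewrite addrK mulrC.
  rewrite (splitr e).
  apply: (le_lt_trans (ler_distD (h^-1 *: (f (h *: 1 + z) - f z)) _ _)).
  by rewrite ltr_leD.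
have [d0 near_d0] := near_f 1 ltr01.
have Q_bounded : \forall h \near 0^', `|Q h| <= `|d0| + 1.
  near=> h; have Qh1 : `|d0 - Q h| < 1 by near: h.
  rewrite -[Q h](subKr d0); apply: le_trans (ler_normB _ _) _.
  by rewrite lerD2l ltW.
by apply: bounded_cauchy_cvg Q_bounded _ => e /near_f.
Unshelve. all: by end_near.
Qed.

End Limits.

(** * Interpolation along an escaping sequence *)

Section Interpolation.
Context {K : numFieldType} (G : set K).
Context (K_archi : forall x : K, 0 <= x -> exists n, x <= n%:R).
Context (closed_ball_compact :
  forall M : K, compact [set z : K | `|z| <= M]).

Lemma exhaustion_nbhs z : open G -> G z ->
  exists j, nbhs z (exhaustion G j).
Proof.
move=> oG Gz; have /nbhs_ballP[e /= e0 eG] : nbhs z G by exact: open_nbhs_nbhs.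
have [m zm] := K_archi (addr_ge0 (normr_ge0 z) ler01).
have e2 : 0 < e / 2 by rewrite divr_gt0.
have e2V : 0 <= (e / 2)^-1 by rewrite invr_ge0 ltW.
have [k ek] := K_archi e2V.
exists (m + k)%N.
have nz : nbhs z (ball z 1) by exact: nbhsx_ballx.
have nze : nbhs z (ball z (e / 2)) by exact: nbhsx_ballx.
apply: filterS (filterI nz nze) => t [/= zt1 zte].
rewrite -ball_normE /= in zt1; rewrite -ball_normE /= in zte; split.
  rewrite -[t](subKr z); apply: le_trans (ler_normB _ _) _.
  apply: (le_trans (lerD (lexx _) (ltW zt1))); apply: le_trans zm _.
  by rewrite ler_nat -addnS leq_addr.
move=> p Gp; apply: (@le_trans _ _ (e / 2)).
  rewrite -[leRHS]invrK lef_pV2 ?posrE ?ltr0n ?invr_gt0 //.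
  by apply: le_trans ek _; rewrite ler_nat -addSn leq_addl.
rewrite real_leNgt ?normr_real ?gtr0_real //; apply/negP => tpe.
apply: Gp; apply: eG; rewrite -ball_normE /=.
by rewrite (splitr e) (le_lt_trans (ler_distD t _ _)) // ltrD.
Qed.

Lemma tail_bound (S : nat -> K -> K) j m0 :
  (forall n, (m0 <= n)%N ->
    lip_bounded (exhaustion G j) (fun z => S n.+1 z - S n z) (2^-1 ^+ n.+1)) ->
  forall m n, (m0 <= m)%N -> (m <= n)%N ->
    lip_bounded (exhaustion G j) (fun z => S n z - S m z) (2^-1 ^+ m).
Proof.
move=> SS m n m0m mn.
(* The telescoping form of the geometric tail is the one that inducts. *)
apply: (@lip_bounded_le _ _ _ (2^-1 ^+ m - 2^-1 ^+ n)).
  by rewrite gerBl exprn_ge0 // invr_ge0.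
elim: n mn => [|n IH].
  rewrite leqn0 => /eqP ->; under eq_fun do rewrite subrr.
  by rewrite subrr; exact: lip_bounded0.
rewrite leq_eqVlt => /predU1P[->|].
  under eq_fun do rewrite subrr.
  by rewrite subrr; exact: lip_bounded0.
rewrite ltnS => mn.
have -> : (fun z => S n.+1 z - S m z) =
    (fun z => (S n.+1 z - S n z) + (S n z - S m z)).
  by apply/funext => z; rewrite addrA subrK.
have -> : 2^-1 ^+ m - 2^-1 ^+ n.+1 =
    2^-1 ^+ n.+1 + (2^-1 ^+ m - 2^-1 ^+ n) :> K.
  by rewrite exprS; field.
by apply: lip_boundedD (IH mn); apply: SS; exact: leq_trans mn.
Qed.

(** The [n]-th term is controlled on the [j]-th set of the exhaustion once
    [n >= j] and [w_n] has left the set of index [4 j + 3], that is, for all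
    large [n]; so the partial sums converge geometrically there, together with
    their Lipschitz constants. *)
Theorem interpolation (w c : nat -> K) : open G -> (forall n, G (w n)) ->
  (forall j, exists m, forall n, (m <= n)%N -> ~ exhaustion G j (w n)) ->
  (forall n m, w n = w m -> c n = c m) ->
  exists2 g : K -> K, forall z, G z -> derivable g z 1 &
    forall n, g (w n) = c n.
Proof.
move=> oG Gw w_esc wc.
have [S [dS Sw S_small]] := interpolating_sums K_archi Gw wc.
have tail j : exists m0, forall m n, (m0 <= m)%N -> (m <= n)%N ->
    lip_bounded (exhaustion G j) (fun z => S n z - S m z) (2^-1 ^+ m).
  have [m far_m] := w_esc (4 * j + 3)%N; exists (maxn m j).
  apply: tail_bound => n; rewrite geq_max => /andP[mn jn].
  by apply: S_small => //; exact: far_m.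
have small e : 0 < e -> exists m, forall n, (m <= n)%N -> 2^-1 ^+ n <= e :> K.
  move=> /(geometric_small K_archi ler01)[m]; rewrite mul1r => me.
  exists m => n mn; apply: le_trans me.
  by rewrite ler_wiXn2l ?invr_ge0 // invf_le1 // ler1n.
pose g z := lim (S n z @[n --> \oo]).
have Sg j z : exhaustion G j z -> S n z @[n --> \oo] --> g z.
  move=> zj; have [m0 SS] := tail j.
  have SSm m n : (m0 <= m)%N -> (m <= n)%N -> `|S n z - S m z| <= 2^-1 ^+ m.
    by move=> m0m mn; have [] := SS m n m0m mn z zj.
  apply: (@bounded_cauchy_cvg _ closed_ball_compact _ (`|S m0 z| + 2^-1 ^+ m0)).
    exists m0 => // n /= m0n; rewrite -[S n z](subrK (S m0 z)) addrC.
    by apply: le_trans (ler_normD _ _) _; rewrite lerD2l SSm.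
  move=> e e0; have e2 : 0 < e / 2 by rewrite divr_gt0.
  have [m me] := small _ e2.
  exists (S (maxn m m0) z), (maxn m m0) => // n /= mn.
  rewrite -ball_normE /= distrC.
  apply: le_lt_trans (SSm _ _ (leq_maxr _ _) mn) _.
  apply: le_lt_trans (me _ (leq_maxl _ _)) _.
  by rewrite ltr_pdivrMr // mulr_natr mulr2n ltrDl.
exists g => [z Gz|n].
  have [j zj] := exhaustion_nbhs oG Gz; have [m0 SS] := tail j.
  apply: (derivable_lip_limit closed_ball_compact zj) => e /small[m me].
  exists (S (maxn m m0)); first exact: dS.
  apply: (@lip_bounded_le _ _ _ (2^-1 ^+ (maxn m m0))).
    by apply: me; exact: leq_maxl.
  apply: (@lip_bounded_lim _ _ (fun n t => S n t - S (maxn m m0) t) _ _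
    (maxn m m0)).
    by move=> t tj; apply: cvgB; [exact: Sg tj|exact: cvg_cst].
  by move=> n mn; apply: SS => //; exact: leq_maxr.
have [j /nbhs_singleton zj] := exhaustion_nbhs oG (Gw n).
apply: (cvg_unique _ (Sg _ _ zj)); first exact: norm_hausdorff.
apply: cvg_near_cst; exists n.+1 => // m /= nm; exact: Sw.
Qed.

End Interpolation.

(** * The complex plane *)

Section ComplexPlane.
Context {R : realType}.
Local Notation C := (R[i]^o).

Lemma complex_archi (x : R[i]) : 0 <= x -> exists n, x <= n%:R.
Proof.
case: x => a b; rewrite lecE /= => /andP[/eqP -> a0].
exists (Num.bound a); rewrite -[_%:R](rmorph_nat (real_complex R)) lecE /= eqxx.
by rewrite ltW // archi_boundP.
Qed.

Lemma norm_real_complex (a : R) : `|a%:C| = `|a|%:C.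
Proof. by rewrite normc_def /= expr0n addr0 sqrtr_sqr. Qed.

Lemma normc_le_ReIm (z : R[i]) :
  `|z| <= `|complex.Re z|%:C + `|complex.Im z|%:C.
Proof.
rewrite {1}[z]complexE; apply: le_trans (ler_normD _ _) _.
rewrite normrM !norm_real_complex lerD2l ler_piMl ?ler0c ?normr_ge0 //.
by rewrite normc_def /= expr0n expr1n add0r sqrtr1.
Qed.

Lemma normc_ge_Im (z : R[i]) : `|complex.Im z|%:C <= `|z|.
Proof.
by rewrite normc_def lecR -sqrtr_sqr ler_sqrt ?lerDr ?addr_ge0 ?sqr_ge0.
Qed.

Lemma continuous_Complex : continuous (fun p : R * R => (p.1 +i* p.2 : C)).
Proof.
move=> p; apply/cvgrPdist_le => e e0.
have e1 : (complex.Re e)%:C = e by rewrite RRe_real // gtr0_real.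
have e2 : 0 < complex.Re e / 2 by rewrite divr_gt0 // -ltcR e1.
have := nbhsx_ballx p _ e2; apply: filterS => q [/= q1 q2].
apply: le_trans (normc_le_ReIm _) _.
rewrite -[leRHS]e1 -rmorphD lecR /= [leRHS]splitr lerD // ltW //.
Qed.

Lemma complex_closed_ball_compact (M : R[i]) :
  compact [set z : C | `|z| <= M].
Proof.
pose m := complex.Re M.
pose box := (`[- m, m]%classic `*` `[- m, m]%classic : set (R * R)).
have box_compact : compact [set (p.1 +i* p.2 : C) | p in box].
  apply: continuous_compact.
    by apply: continuous_subspaceT => p; exact: continuous_Complex.
  by apply: compact_setX; exact: segment_compact.
apply: subclosed_compact box_compact _; first exact: closed_norm_le.
move=> z /= zM.
have zm : `|z| <= m%:C.
  by rewrite /m RRe_real // ger0_real // (le_trans _ zM).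
exists (complex.Re z, complex.Im z); last by case: (z).
split; rewrite /= in_itv /= -ler_norml -lecR; apply: le_trans zm.
  exact: normc_ge_Re.
exact: normc_ge_Im.
Qed.

(** The difference quotient at [z] with increment [h] is the conjugate of the
    one of [g] at [conj z] with increment [conj h]. *)
Lemma derivable_conj (g : C -> C) (z : C) :
  derivable g (conjc z) 1 ->
  derivable (fun t : C => conjc (g (conjc t)) : C) z 1.
Proof.
move=> dg; apply/cvg_ex; exists (conjc ('D_1 g (conjc z))).
apply/cvgrPdist_le => e e0.
have /cvgrPdist_le/(_ e e0) := dg.
move=> /nbhs_ballP[d /= d0 dP]; apply/nbhs_ballP; exists d => //= h hd h0.
have hd' : ball (0 : C) d (conjc h).
  move: hd; rewrite -!ball_normE /= !sub0r !normrN.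
  by rewrite [in X in _ -> X](normcJ h).
have h0' : conjc h != 0 by rewrite conjc_eq0.
have := dP _ hd' h0'; rewrite /= -[X in X <= _ -> _]normcJ.
congr (`|_| <= _); rewrite rmorphB; congr (_ - _).
rewrite /GRing.scale /= !mulr1 [LHS]rmorphM rmorphB /= conjc_inv conjcK.
by rewrite -(rmorphD conjc).
Qed.

End ComplexPlane.

(** * Interpolation by symmetric holomorphic functions *)

Section SymmetricInterpolation.
Context {R : realType}.
Local Notation C := (R[i]^o).
Context (G : set C) (G_conj : forall z, G z -> G (conjc z)).

Lemma exhaustion_conj j (z : R[i]) :
  exhaustion G j z -> exhaustion G j (conjc z).
Proof.
move=> [zj Gz]; split; first by rewrite normcJ.
move=> p Gp; have -> : `|conjc z - p| = `|z - conjc p|.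
  by rewrite -normcJ rmorphB /= conjcK.
by apply: Gz => /G_conj; rewrite conjcK.
Qed.

(** Otherwise some subsequence stays in a bounded set, hence has a cluster
    point [p].  Points of the exhaustion keep their distance from the complement
    of [G], so [p] lies in [G]; it also lies in the closed upper half plane, and
    this contradicts discreteness. *)
Lemma discrete_seq_escapes (z : nat -> C) :
  (forall n, upper_part G (z n)) -> discrete_seq_in (upper_part G) z ->
  forall j, exists m, forall n, (m <= n)%N -> ~ exhaustion G j (z n).
Proof.
move=> zG z_discrete j; apply: contrapT => /forallNP return_z.
have /choice[s sP] m : exists n, (m <= n)%N /\ exhaustion G j (z n).
  have /existsNP[n /not_implyP[mn /contrapT zn]] := return_z m.
  by exists n.
have [|p [_ p_cluster]] := @complex_closed_ball_compact _ j.+1%:R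
    (z \o s @ \oo) _.
  by exists 0%N => // m _; have [_ []] := sP m.
have close e : 0 < e -> exists m, `|p - z (s m)| < e.
  move=> e0; have zsj : (z \o s @ \oo) (range (z \o s)).
    by exists 0%N => // m _; exists m.
  have [_ [[m _ <-]]] := p_cluster _ _ zsj (nbhsx_ballx p e e0).
  by rewrite -ball_normE; exists m.
have Gp : G p.
  apply: contrapT => Gp.
  have [|m] := close j.+1%:R^-1; first by rewrite invr_gt0 ltr0n.
  have [_ [_ /(_ p Gp)]] := sP m; rewrite distrC => le_p lt_p.
  by have := le_lt_trans le_p lt_p; rewrite ltxx.
have p_up : 0 <= complex.Im p.
  rewrite leNgt; apply/negP => p0.
  have [|m] := close (- complex.Im p)%:C; first by rewrite ltcR oppr_gt0.
  move=> /(le_lt_trans (normc_ge_Im _)); rewrite ltcR raddfB /= distrC.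
  have [_ z_up] := zG (s m) => /(le_lt_trans (ler_norm _)).
  by rewrite ltrBlDr addNr ltNge z_up.
have : (upper_part G `&` cluster (z @ \oo)) p.
  split=> // A B zA pB; apply: p_cluster pB.
  case: zA => N _ NA; exists N => // m /= Nm; apply: NA => /=.
  by have [ms _] := sP m; exact: leq_trans ms.
by rewrite z_discrete.
Qed.

(** Interpolate along the sequence in which every [z n] is followed by its
    conjugate, with conjugate values, and symmetrise the result.  Real points
    occur twice in that sequence, and there the reality of [c n] makes the two
    requirements equal. *)
Lemma symmetric_interpolation (z c : nat -> C) : open G ->
  (forall n, upper_part G (z n)) -> injective z ->
  discrete_seq_in (upper_part G) z ->
  (forall n, complex.Im (z n) = 0 -> complex.Im (c n) = 0) ->
  exists g : C -> C, [/\ forall t, G t -> derivable g t 1,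
    forall t, g (conjc t) = conjc (g t) & forall n, g (z n) = c n].
Proof.
move=> oG zG z_inj z_discrete c_real.
(* [z 0, conj (z 0), z 1, conj (z 1)] and so on. *)
pose refl (u : nat -> C) n : C := if odd n then conjc (u n./2) else u n./2.
have Im0_conj (t : C) : complex.Im t = 0 -> conjc t = t.
  by case: t => a b /= ->; rewrite oppr0.
have z_conj n m : z n = conjc (z m) -> n = m /\ complex.Im (z n) = 0.
  move=> znm; have [[_ n_up] [_ m_up]] := (zG n, zG m).
  have Im_n : complex.Im (z n) = - complex.Im (z m).
    by rewrite znm; case: (z m).
  have m0 : complex.Im (z m) = 0.
    by apply/eqP; rewrite eq_le m_up andbT -oppr_ge0 -Im_n.
  by split; [apply: z_inj; rewrite znm Im0_conj|rewrite Im_n m0 oppr0].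
have refl_G n : G (refl z n).
  by rewrite /refl; case: ifP => _; [apply: G_conj|]; case: (zG n./2).
have refl_escapes j : exists m, forall n, (m <= n)%N ->
    ~ exhaustion G j (refl z n).
  have [m mP] := discrete_seq_escapes zG z_discrete j.
  exists m.*2 => n mn; have mn2 : (m <= n./2)%N.
    by rewrite -[m]doubleK half_leq.
  rewrite /refl; case: ifP => _; last exact: mP.
  by move=> /exhaustion_conj; rewrite conjcK; exact: mP.
have refl_eq n m : refl z n = refl z m -> refl c n = refl c m.
  rewrite /refl; case: ifP => _; case: ifP => _.
  - by move=> /(can_inj (@conjcK R))/z_inj ->.
  - by move=> /esym/z_conj[-> /c_real/Im0_conj].
  - by move=> /z_conj[-> /c_real/Im0_conj].
  - by move=> /z_inj ->.
have [g dg gP] := interpolation (@complex_archi R)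
  (@complex_closed_ball_compact R) oG refl_G refl_escapes refl_eq.
have gz n : g (z n) = c n.
  by have := gP n.*2; rewrite /refl odd_double doubleK.
have gzc n : g (conjc (z n)) = conjc (c n).
  by have := gP n.*2.+1; rewrite /refl /= odd_double /= uphalf_double.
exists (fun t : C => 2^-1 * (g t + conjc (g (conjc t)))); split.
- move=> t Gt.
  have dgc := derivable_conj (dg _ (G_conj Gt)).
  have h := derivableZ (k := 2^-1) (@derivableD _ C C g _ t 1 (dg t Gt) dgc).
  exact: h.
- have half : conjc 2^-1 = 2^-1 :> R[i] by rewrite conjc_inv conjc_nat.
  have conjcM (a b : R[i]) : conjc (a * b) = conjc a * conjc b.
    exact: rmorphM.
  have conjcD (a b : R[i]) : conjc (a + b) = conjc a + conjc b.
    exact: rmorphD.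
  by move=> t; rewrite conjcM half conjcD !conjcK addrC.
- move=> n; rewrite gz gzc conjcK -mulr2n -(mulr_natl (c n)).
  by rewrite mulKf // pnatr_eq0.
Qed.

End SymmetricInterpolation.

(** * Slice functions *)

Section SliceFunctions.
Context {R : realType} (A : altStarAlgType R).

Lemma amulZl (c : R) (u v : A) : (c *: u) ** v = c *: (u ** v).
Proof.
have h := amul_linearl v c u 0.
have v0 : (0 : A) ** v = 0.
  apply: (addrI (0 ** v)).
  by have := amul_linearl v 1 0 0; rewrite !scale1r !addr0.
by move: h; rewrite /= v0 !addr0.
Qed.

Lemma amulZr (c : R) (u v : A) : u ** (c *: v) = c *: (u ** v).
Proof.
have h := amul_linearr u c v 0.
have v0 : u ** (0 : A) = 0.
  apply: (addrI (u ** 0)).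
  by have := amul_linearr u 1 0 0; rewrite !scale1r !addr0.
by move: h; rewrite /= v0 !addr0.
Qed.

Lemma amul0r (u : A) : u ** 0 = 0.
Proof. by have := amulZr 0 u 0; rewrite !scale0r. Qed.

Lemma amulDl (u u' v : A) : (u + u') ** v = u ** v + u' ** v.
Proof. by have := amul_linearl v 1 u u'; rewrite /= !scale1r. Qed.

Lemma amulNr (u v : A) : u ** (- v) = - (u ** v).
Proof. by rewrite -scaleN1r amulZr scaleN1r. Qed.

Lemma pseudosphere_conj (I : A) : pseudosphere A I -> aconj I = - I.
Proof. by case=> + _ => /eqP; rewrite addrC addr_eq0 => /eqP. Qed.

Lemma pseudosphere_sqr (I : A) : pseudosphere A I -> I ** I = - aone A.
Proof.
move=> SI; case: (SI) => _.
by rewrite pseudosphere_conj // amulNr => <-; rewrite opprK.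
Qed.

Lemma aone_inj (a b : R) : a *: aone A = b *: aone A -> a = b.
Proof.
move/eqP; rewrite -subr_eq0 -scalerBl scaler_eq0.
by rewrite (negPf (aone_neq0 (s := A))) orbF subr_eq0 => /eqP.
Qed.

(** Adding the equation to its [aconj] image compares the real parts, and
    squaring what remains compares the squares of the imaginary parts. *)
Lemma slice_point_eq (z w : R[i]) (I J : A) :
  pseudosphere A I -> pseudosphere A J -> slice_point z I = slice_point w J ->
  [\/ z = w /\ I = J, z = conjc w /\ I = - J | z = w /\ complex.Im z = 0].
Proof.
case: z w => [x y] [x' y'] SI SJ; rewrite /slice_point /= => eq_q.
have conj_slice r s K : pseudosphere A K ->
    aconj (r *: aone A + s *: K) = r *: aone A - s *: K.
  move=> SK.
  have c0 : aconj (0 : A) = 0.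
    by have := aconj_real (s := A) 0; rewrite !scale0r.
  have cs : aconj (s *: K) = - (s *: K).
    have := aconj_linear (s := A) s K 0; rewrite /= c0 !addr0 => ->.
    by rewrite pseudosphere_conj // scalerN.
  have c1 : aconj (aone A) = aone A.
    by have := aconj_real (s := A) 1; rewrite !scale1r.
  have := aconj_linear (s := A) r (aone A) (s *: K); rewrite /= => ->.
  by rewrite cs c1.
have eq_conj : x *: aone A - y *: I = x' *: aone A - y' *: J.
  by rewrite -!conj_slice // eq_q.
have xx' : x = x'.
  have : (x *+ 2) *: aone A = (x' *+ 2) *: aone A.
    have add_conj r s (K : A) :
        (r *: aone A + s *: K) + (r *: aone A - s *: K) = (r *+ 2) *: aone A.
      by rewrite addrACA subrr addr0 -scalerDl -mulr2n.
    by rewrite -(add_conj x y I) -(add_conj x' y' J) eq_q eq_conj.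
  by move/aone_inj/eqP; rewrite eqrMn2r => /eqP.
have yy' : y *: I = y' *: J by move: eq_q; rewrite xx' => /addrI.
have : y ^+ 2 = y' ^+ 2.
  have := congr2 (@amul R A) yy' yy'; rewrite !amulZl !amulZr.
  rewrite !pseudosphere_sqr // !scalerN => /oppr_inj; rewrite !scalerA.
  by move/aone_inj; rewrite -!expr2.
have [-> /esym/eqP|y0] := eqVneq y 0.
  by rewrite expr0n /= sqrf_eq0 => /eqP ->; apply: Or33; rewrite xx'.
move/eqP; rewrite eqf_sqr => /orP[]/eqP yE.
  apply: Or31; rewrite xx' yE; split => //.
  by move: yy'; rewrite -yE => /(scalerI y0).
apply: Or32; rewrite xx' yE; split => //.
by apply: (scalerI y0); rewrite yy' yE scaleNr scalerN opprK.
Qed.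

(** A point has several representations [x + y I]; the symmetry of [F] makes
    [F' + I F''] independent of the choice: replacing [(z, I)] by
    [(conj z, - I)] changes two signs, and at a real point [F''] vanishes. *)
Lemma stem_slice_regular (G : set R[i]^o) (F : R[i]^o -> complexification A) :
  stem_function G F ->
  exists2 f : axially_symmetric A G -> A, slice_regular f &
    forall z I (q : axially_symmetric A G), G z -> pseudosphere A I ->
      set_val q = slice_point z I -> f q = (F z).1 + I ** (F z).2.
Proof.
move=> F_stem; have [_ F_conj] := F_stem.
have conj_fixed (w : R[i]) : complex.Im w = 0 -> conjc w = w.
  by case: w => a b /= ->; rewrite oppr0.
have F_eq z w I J : G z -> G w -> pseudosphere A I -> pseudosphere A J ->
    slice_point z I = slice_point w J ->
    (F z).1 + I ** (F z).2 = (F w).1 + J ** (F w).2.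
  move=> Gz Gw SI SJ /(slice_point_eq SI SJ)[[-> -> //]|[-> ->]|[-> z0]].
    rewrite F_conj //=; congr (_ + _).
    rewrite amulNr -scaleN1r -[- J]scaleN1r amulZl scalerA.
    by rewrite mulrNN mulr1 scale1r.
  have : (F w).2 = - (F w).2.
    by rewrite -[X in X = _]/(F w).2 -[in LHS](conj_fixed w z0) F_conj.
  move/eqP; rewrite -addr_eq0 -mulr2n -scaler_nat scaler_eq0 pnatr_eq0 /=.
  by move=> /eqP ->; rewrite !amul0r.
have /choice[zI zIP] (q : axially_symmetric A G) : exists zI : R[i] * A,
    [/\ G zI.1, pseudosphere A zI.2 & set_val q = slice_point zI.1 zI.2].
  by have [z [I [Gz SI qE]]] := set_valP q; exists (z, I).
pose f q := (F (zI q).1).1 + (zI q).2 ** (F (zI q).1).2.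
have fP z I (q : axially_symmetric A G) : G z -> pseudosphere A I ->
      set_val q = slice_point z I -> f q = (F z).1 + I ** (F z).2.
  move=> Gz SI qE; have [Gq Sq qE'] := zIP q.
  by apply: F_eq => //; rewrite -qE -qE'.
by exists f => //; exists F.
Qed.

(** Each coordinate of [v n] in a real basis of [A] is a complex number, and
    it is real wherever [z n] is; so the coordinates are interpolated one by
    one. *)
Lemma stem_interpolation (G : set R[i]^o) (z : nat -> R[i]^o)
    (v : nat -> complexification A) :
  open G -> (forall t, G t -> G (conjc t)) ->
  (forall n, upper_part G (z n)) -> injective z ->
  discrete_seq_in (upper_part G) z ->
  (forall n, complex.Im (z n) = 0 -> (v n).2 = 0) ->
  exists2 F : R[i]^o -> complexification A, stem_function G F &
    forall n, F (z n) = v n.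
Proof.
move=> oG G_conj zG z_inj z_discrete v_real.
pose e := vbasis {:A}.
have /choice[g gP] (k : 'I_(\dim {:A})) := symmetric_interpolation
    (c := fun n => coord e k (v n).1 +i* coord e k (v n).2)
    G_conj oG zG z_inj z_discrete
    (fun n zn => etrans (congr1 _ (v_real n zn)) (linear0 _)).
pose F (t : R[i]^o) : complexification A :=
  (\sum_k complex.Re (g k t) *: e`_k, \sum_k complex.Im (g k t) *: e`_k).
(* Scalars act on [A_C] through the real basis vectors [e`_k], so holomorphy
   of [F] reduces to that of each [g k]. *)
have FE : F =
    \sum_k (fun t : R[i]^o => g k t *: ((e`_k, 0) : complexification A)).
  apply/funext => t; rewrite fct_sumE [RHS]surjective_pairing /F.
  have sum1 (u : 'I_(\dim {:A}) -> complexification A) :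
      (\sum_k u k).1 = \sum_k (u k).1.
    exact: (big_morph (fun w : complexification A => w.1)).
  have sum2 (u : 'I_(\dim {:A}) -> complexification A) :
      (\sum_k u k).2 = \sum_k (u k).2.
    exact: (big_morph (fun w : complexification A => w.2)).
  rewrite sum1 sum2; congr pair; apply: eq_bigr => k _ /=.
    by rewrite scaler0 subr0.
  by rewrite scaler0 add0r.
exists F; first split.
- move=> t Gt; rewrite FE; apply: derivable_sum => k.
  have [dg _ _] := gP k.
  apply/cvg_ex; exists ('D_1 (g k) t *: ((e`_k, 0) : complexification A)).
  have cvE := cvgZr_tmp (a := (e`_k, 0) : complexification A) (dg t Gt).
  apply: (cvg_trans _ (cvE _)); apply: near_eq_cvg; apply: nearW => h.
  by rewrite /= -scalerBl scalerA.
- move=> t _; congr pair; rewrite -?sumrN; apply: eq_bigr => k _;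
    by have [_ -> _] := gP k; case: (g k t) => a b; rewrite //= scaleNr.
- move=> n; rewrite [v n]surjective_pairing; congr pair;
  rewrite [RHS](coord_vbasis (memvf _));
  by apply: eq_bigr => k _; have [_ _ ->] := gP k.
Qed.

End SliceFunctions.

Theorem theorem11p2 (R : realType) (A : altStarAlgType R) (G : set R[i]^o)
    (G_symm : symmetric_domain G) (x y : nat -> R)
    (xy_G : forall n, upper_part G (x n +i* y n))
    (xy_inj : injective (fun n => x n +i* y n))
    (xy_discrete : discrete_seq_in (upper_part G) (fun n => x n +i* y n))
    (L : nat -> A -> A) (L_affine : forall n, left_affine (L n)) :
  exists2 f : axially_symmetric A G -> A, slice_regular f &
    forall (n : nat) (q : axially_symmetric A G),
      sphere A (x n) (y n) (set_val q) -> f q = L n (set_val q).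
Proof.
have [_ G_open G_conj _] := G_symm.
have {}G_conj z : G z -> G (conjc z) by move/G_conj.
have /choice[a /choice[b LE]] := L_affine.
have [F F_stem FE] := @stem_interpolation _ A _ _
  (fun n => (a n + x n *: b n, y n *: b n)) G_open G_conj xy_G xy_inj
  xy_discrete (fun n yn => etrans (congr1 (fun r => r *: b n) yn) (scale0r _)).
have [f f_regular fE] := stem_slice_regular F_stem.
exists f => // n q [I SI /esym qE].
have [Gn _] := xy_G n.
rewrite (fE _ _ _ Gn SI qE) FE LE qE /=.
by rewrite amulDl !amulZl amul1x amulZr addrA.
Qed.
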